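(* Let $n$ be an even positive integer. If $n \equiv 2 \pmod 4$, then $$A_n = \frac{16}{2^{n}\pi} \sum_{j=0}^{(n-2)/4} \binom{n}{2j}\frac{1}{(n/2-2j)^2},$$ and if $n \equiv 0 \pmod 4$, then $$A_n = \frac{16}{2^{n}\pi} \sum_{j=0}^{(n-4)/4} \binom{n}{2j+1}\frac{1}{(n/2-(2j+1))^2}.$$
   Context: For a positive integer $n$, $A_n$ denotes the limiting area between the graphs of $\cos^n x$ and $\cos^n kx$ over $[0,\pi]$: $$A_n = \lim_{k \to \infty} \int_0^\pi \big| \cos^n x - \cos^n (kx) \big| \, dx,$$ where $k$ runs through the positive integers (both parities). Here $\cos^n \theta = (\cos\theta)^n$. The claim includes that this limit exists. *)

(* Defs.v *)
(* Stdlib real numbers, with Coquelicot for integrals and limits. *)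
From Stdlib Require Import Reals Arith.
From Coquelicot Require Import Coquelicot.

Open Scope R_scope.

Definition area_between (n k : nat) : R :=
  RInt (fun x : R => Rabs (cos x ^ n - cos (INR k * x) ^ n)) 0 PI.

(* "The limit defining A_n exists and A_n = A".  The sequence is indexed from
   k = 0 rather than k = 1, which does not affect the limit. *)
Definition is_limiting_area (n : nat) (A : R) : Prop :=
  is_lim_seq (area_between n) (Finite A).

(* Main.v *)
Require Import Defs.
From Stdlib Require Import Reals Arith Lra Lia.
From Coquelicot Require Import Coquelicot.

Open Scope R_scope.

(** For even n the function f(x) = cos^n x has period PI, is symmetric about
    PI/2 and decreases on [0, PI/2].  The proof has three ingredients.

    - Averaging ([averaging]).  If g(x, y) is Lipschitz and T-periodic in y,
      then over one period of y = kx the slow variable x moves by only T/k, so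
      on an interval of length T/k the integral of g(x, kx) agrees with that of
      the mean G(x)/T, G(x) = int_0^T g(x, y) dy, up to O(1/k^2).  The k
      intervals making up [0, T] give a total error O(1/k).  With
      g(x, y) = |f(x) - f(y)| the limiting area is (1/T) int_0^T G.

    - The mean oscillation ([oscillation_limit]).  By symmetry everything
      reduces to [0, h] with h = T/2, where f is monotone and the absolute
      value can be resolved.  For F the primitive of f vanishing at 0,
      G(x) = 2 (2 F(x) - F(h) + (h - 2x) f(x)), which is 4 (h - 2x) f(x) plus
      the derivative of 2 ((2x - h) F(x) - x F(h)), a function vanishing at
      both 0 and h.  So the limit is (4/h) int_0^h (h - 2x) f(x) dx, without
      any exchange of double integrals.

    - The Fourier expansion 2^n cos^n x = sum_m C(n,m) cos((n - 2m) x)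
      ([cos_pow_fourier]).  With n - 2m = 2q and h = PI/2, the weighted integral
      of cos(2qx) is (1 - cos(q PI)) / (2 q^2), that is 1/q^2 for q odd and 0
      for q even, while it is 0 for q = 0.  The terms m and n - m coincide, so
      the sum is twice its part m < n/2, in which only the m with n/2 - m odd
      survive: the even m when n = 2 mod 4, the odd m when n = 0 mod 4. *)

(** * Integrals of continuous real functions *)

Definition lipschitz (L : R) (f : R -> R) : Prop :=
  forall x y, Rabs (f x - f y) <= L * Rabs (x - y).

Lemma lipschitz_continuous L f x : lipschitz L f -> continuous f x.
Proof.
  intros Hf.
  apply continuity_pt_filterlim.
  intros eps Heps.
  exists (eps / (Rabs L + 1)); split.
  - apply Rdiv_lt_0_compat; [exact Heps | pose proof (Rabs_pos L); lra].
  - intros y [_ Hy]; simpl in Hy |- *; unfold Rdist in *.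
    apply Rle_lt_trans with (1 := Hf y x).
    pose proof (Rabs_pos L); pose proof (Rle_abs L); pose proof (Rabs_pos (y - x)).
    apply Rmult_lt_compat_r with (r := Rabs L + 1) in Hy; [| lra].
    unfold Rdiv in Hy; rewrite Rmult_assoc, Rinv_l, Rmult_1_r in Hy by lra.
    nra.
Qed.

Lemma continuous_ex_RInt (f : R -> R) a b :
  (forall x, continuous f x) -> ex_RInt f a b.
Proof.
  intros Hf; apply (ex_RInt_continuous f); intros z _; apply Hf.
Qed.

Lemma lipschitz_ex_RInt L f a b : lipschitz L f -> ex_RInt f a b.
Proof.
  intros Hf; apply continuous_ex_RInt; intros x; exact (lipschitz_continuous L f x Hf).
Qed.

Lemma RInt_Rminus (f g : R -> R) a b :
  ex_RInt f a b -> ex_RInt g a b ->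
  RInt (fun x => f x - g x) a b = RInt f a b - RInt g a b.
Proof. intros Hf Hg; exact (RInt_minus f g a b Hf Hg). Qed.

Lemma RInt_Rmult (c : R) (f : R -> R) a b :
  ex_RInt f a b -> RInt (fun x => c * f x) a b = c * RInt f a b.
Proof. intros Hf; exact (RInt_scal (V := R_CompleteNormedModule) f a b c Hf). Qed.

Lemma RInt_Rchasles (f : R -> R) b a c :
  (forall x, continuous f x) ->
  RInt f a c = RInt f a b + RInt f b c.
Proof.
  intros Hf; symmetry.
  apply (RInt_Chasles f a b c); now apply continuous_ex_RInt.
Qed.

Lemma periodic_shift T (f : R -> R) i :
  (forall x, f (x + T) = f x) -> forall x, f (x + INR i * T) = f x.
Proof.
  intros HT; induction i as [|i IH]; intros x.
  - simpl; f_equal; ring.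
  - rewrite S_INR, <- (IH x), <- (HT (x + INR i * T)); f_equal; ring.
Qed.

(** The i-th interval of length T/k is mapped by x |-> kx onto a full period. *)
Lemma RInt_lin_periodic T (f : R -> R) (k : R) (i : nat) :
  (forall x, continuous f x) -> (forall x, f (x + T) = f x) -> 0 < k ->
  RInt (fun x => f (k * x)) (INR i * T / k) (INR (S i) * T / k) = RInt f 0 T / k.
Proof.
  intros Hf HT Hk.
  assert (E : RInt (fun x => k * f (k * x)) (INR i * T / k) (INR (S i) * T / k)
              = RInt f 0 T).
  { rewrite <- (RInt_ext (fun x => scal k (f (k * x + 0)))).
    2: { intros x _; unfold scal; simpl; unfold mult; simpl.
         now rewrite Rplus_0_r. }
    rewrite (RInt_comp_lin f) by now apply continuous_ex_RInt.
    replace (k * (INR i * T / k) + 0) with (1 * 0 + INR i * T) by (field; lra).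
    replace (k * (INR (S i) * T / k) + 0) with (1 * T + INR i * T)
      by (rewrite S_INR; field; lra).
    rewrite <- (RInt_comp_lin f) by now apply continuous_ex_RInt.
    apply RInt_ext; intros x _; unfold scal; simpl; unfold mult; simpl.
    rewrite Rmult_1_l, Rmult_1_l; now apply periodic_shift. }
  rewrite <- E.
  rewrite (RInt_Rmult k (fun x => f (k * x))).
  - assert (Hdiv : forall r : R, r = k * r / k) by (intros r; field; lra).
    apply Hdiv.
  - apply continuous_ex_RInt; intros x.
    apply (continuous_comp (fun x => k * x) f); [| apply Hf].
    apply (continuous_mult (fun _ => k) (fun x => x)); 
      [apply continuous_const | apply continuous_id].
Qed.

(** * Averaging over a fast periodic variable *)

Section Averaging.

Variables (g : R -> R -> R) (L T : R).
Hypothesis HT : 0 < T.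
Hypothesis g_lip : forall x x' y y',
  Rabs (g x y - g x' y') <= L * (Rabs (x - x') + Rabs (y - y')).
Hypothesis g_per : forall x y, g x (y + T) = g x y.

Let G (x : R) : R := RInt (g x) 0 T.

Lemma slice_lipschitz x : lipschitz L (g x).
Proof.
  intros y y'; pose proof (g_lip x x y y') as H.
  now rewrite Rminus_diag, Rabs_R0, Rplus_0_l in H.
Qed.

(** The Lipschitz inequality at two distinct points forces this sign. *)
Lemma lipschitz_nonneg : 0 <= L.
Proof.
  pose proof (g_lip 1 0 0 0) as H; pose proof (Rabs_pos (g 1 0 - g 0 0)).
  rewrite Rminus_0_r, Rabs_R1, Rminus_0_r, Rabs_R0 in H; lra.
Qed.

Lemma slice_integral_lipschitz : lipschitz (L * T) G.
Proof.
  intros x x'; unfold G.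
  rewrite <- RInt_Rminus by (eapply lipschitz_ex_RInt, slice_lipschitz).
  replace (L * T * Rabs (x - x')) with ((T - 0) * (L * Rabs (x - x'))) by ring.
  apply abs_RInt_le_const; [lra | |].
  - apply (ex_RInt_minus (g x) (g x')); eapply lipschitz_ex_RInt, slice_lipschitz.
  - intros t _; pose proof (g_lip x x' t t) as H.
    now rewrite Rminus_diag, Rabs_R0, Rplus_0_r in H.
Qed.

Lemma diagonal_lipschitz k :
  0 <= k -> lipschitz (L * (1 + k)) (fun x => g x (k * x)).
Proof.
  intros Hk x x'.
  eapply Rle_trans; [apply g_lip |].
  rewrite <- Rmult_minus_distr_l, Rabs_mult, (Rabs_pos_eq k) by exact Hk.
  apply Req_le; ring.
Qed.

Lemma defect_continuous k x :
  0 <= k -> continuous (fun x => g x (k * x) - G x / T) x.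
Proof.
  intros Hk.
  apply (continuous_minus (fun x => g x (k * x)) (fun x => G x / T)).
  - exact (lipschitz_continuous _ _ x (diagonal_lipschitz k Hk)).
  - apply (continuous_mult G (fun _ => / T)); [| apply continuous_const].
    exact (lipschitz_continuous _ _ x slice_integral_lipschitz).
Qed.

(** Freezing the slow variable at the left end a of the interval makes the
    integral vanish exactly, since kx runs through one full period.  Freezing
    costs at most L T/k pointwise for g and again L T/k for G/T, whence the
    factor 2; the interval has length T/k. *)
Lemma averaging_defect_period (k : R) (i : nat) :
  0 < k ->
  Rabs (RInt (fun x => g x (k * x) - G x / T) (INR i * T / k) (INR (S i) * T / k))
  <= 2 * L * (T / k) ^ 2.
Proof.
  intros Hk.
  set (a := INR i * T / k); set (b := INR (S i) * T / k).
  assert (Hba : b - a = T / k) by (unfold a, b; rewrite S_INR; field; lra).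
  assert (HTk : 0 < T / k) by now apply Rdiv_lt_0_compat.
  pose proof lipschitz_nonneg as HL.
  assert (Hga : lipschitz (L * k) (fun x => g a (k * x))).
  { intros x x'; eapply Rle_trans; [apply slice_lipschitz |].
    rewrite <- Rmult_minus_distr_l, Rabs_mult, (Rabs_pos_eq k) by lra.
    apply Req_le; ring. }
  assert (Hzero : RInt (fun x => g a (k * x) - G a / T) a b = 0).
  { rewrite RInt_Rminus.
    - unfold a at 2, b; rewrite RInt_lin_periodic; [| | apply g_per | exact Hk].
      + rewrite RInt_const.
        assert (Hcancel : forall r : R, r / k - (b - a) * (r / T) = 0)
          by (intros r; rewrite Hba; field; lra).
        apply Hcancel.
      + intros x; eapply lipschitz_continuous, slice_lipschitz.
    - eapply lipschitz_ex_RInt, Hga.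
    - apply ex_RInt_const. }
  assert (Hex0 : ex_RInt (fun x => g a (k * x) - G a / T) a b).
  { apply (ex_RInt_minus (fun x => g a (k * x)) (fun _ => G a / T)).
    - eapply lipschitz_ex_RInt, Hga.
    - apply ex_RInt_const. }
  assert (Hex : ex_RInt (fun x => g x (k * x) - G x / T) a b).
  { apply continuous_ex_RInt; intros x; apply defect_continuous; lra. }
  rewrite <- (Rminus_0_r (RInt _ a b)), <- Hzero, <- RInt_Rminus by assumption.
  replace (2 * L * (T / k) ^ 2) with ((b - a) * (2 * L * (T / k)))
    by (rewrite Hba; ring).
  apply abs_RInt_le_const; [lra | now apply (ex_RInt_minus (V := R_NormedModule)) |].
  intros t Ht.
  assert (Hta : Rabs (t - a) <= T / k) by (rewrite Rabs_pos_eq; lra).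
  replace (g t (k * t) - G t / T - (g a (k * t) - G a / T))
    with ((g t (k * t) - g a (k * t)) - (G t - G a) / T) by (field; lra).
  eapply Rle_trans; [apply Rabs_triang |]; rewrite Rabs_Ropp.
  unfold Rdiv at 1; rewrite Rabs_mult, (Rabs_pos_eq (/ T))
    by (left; now apply Rinv_0_lt_compat).
  pose proof (g_lip t a (k * t) (k * t)) as H1.
  rewrite Rminus_diag, Rabs_R0, Rplus_0_r in H1.
  pose proof (slice_integral_lipschitz t a) as H2.
  apply Rmult_le_compat_r with (r := / T) in H2;
    [| left; now apply Rinv_0_lt_compat].
  replace (L * T * Rabs (t - a) * / T) with (L * Rabs (t - a)) in H2
    by (field; lra).
  pose proof (Rmult_le_compat_l L _ _ HL Hta).
  lra.
Qed.

Lemma averaging_defect (k : R) (i : nat) :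
  0 < k ->
  Rabs (RInt (fun x => g x (k * x) - G x / T) 0 (INR i * T / k))
  <= INR i * (2 * L * (T / k) ^ 2).
Proof.
  intros Hk; induction i as [|i IH].
  - replace (INR 0 * T / k) with 0 by (simpl; field; lra).
    rewrite RInt_point; change (@zero R_CompleteNormedModule) with 0.
    rewrite Rabs_R0; simpl; lra.
  - rewrite (RInt_Rchasles _ (INR i * T / k))
      by (intros x; apply defect_continuous; lra).
    eapply Rle_trans; [apply Rabs_triang |].
    pose proof (averaging_defect_period k i Hk).
    rewrite S_INR at 2; lra.
Qed.

Theorem averaging :
  is_lim_seq (fun k => RInt (fun x => g x (INR k * x)) 0 T)
             (Finite (RInt G 0 T / T)).
Proof.
  set (A := RInt G 0 T / T).
  assert (Hlim : is_lim_seq (fun k => 2 * L * T ^ 2 * / INR k) 0).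
  { replace (Finite 0) with (Rbar_mult (2 * L * T ^ 2) 0)
      by (simpl; f_equal; ring).
    apply is_lim_seq_scal_l.
    replace (Finite 0) with (Rbar_inv p_infty) by reflexivity.
    apply is_lim_seq_inv; [apply is_lim_seq_INR | discriminate]. }
  assert (Hbound : forall k, (1 <= k)%nat ->
    Rabs (RInt (fun x => g x (INR k * x)) 0 T - A) <= 2 * L * T ^ 2 * / INR k).
  { intros k Hk.
    assert (Hk0 : 0 < INR k) by (apply lt_0_INR; lia).
    assert (HG : ex_RInt G 0 T) by (eapply lipschitz_ex_RInt, slice_integral_lipschitz).
    assert (EA : A = RInt (fun x => G x / T) 0 T).
    { symmetry; rewrite (RInt_ext _ (fun x => / T * G x))
        by (intros x _; exact (Rmult_comm (G x) (/ T))).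
      rewrite RInt_Rmult by exact HG; apply Rmult_comm. }
    rewrite EA, <- RInt_Rminus.
    - pose proof (averaging_defect (INR k) k Hk0) as H.
      replace (INR k * T / INR k) with T in H by (field; lra).
      replace (2 * L * T ^ 2 * / INR k) with (INR k * (2 * L * (T / INR k) ^ 2))
        by (field; lra).
      exact H.
    - eapply lipschitz_ex_RInt, diagonal_lipschitz; lra.
    - apply continuous_ex_RInt; intros x.
      apply (continuous_mult G (fun _ => / T)); [| apply continuous_const].
      exact (lipschitz_continuous _ _ x slice_integral_lipschitz). }
  apply is_lim_seq_le_le_loc
    with (u := fun k => A - 2 * L * T ^ 2 * / INR k)
         (w := fun k => A + 2 * L * T ^ 2 * / INR k).
  - exists 1%nat; intros k Hk.
    specialize (Hbound k Hk); apply Rabs_le_between in Hbound; lra.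
  - replace (Finite A) with (Finite (A - 0)) by (f_equal; ring).
    apply is_lim_seq_minus'; [apply is_lim_seq_const | exact Hlim].
  - replace (Finite A) with (Finite (A + 0)) by (f_equal; ring).
    apply is_lim_seq_plus'; [apply is_lim_seq_const | exact Hlim].
Qed.

End Averaging.

(** * Mean oscillation of a symmetric unimodal function *)

Section Oscillation.

Variables (f : R -> R) (L h : R).
Hypothesis Hh : 0 < h.
Hypothesis f_lip : lipschitz L f.
Hypothesis f_refl : forall x, f (2 * h - x) = f x.

Let f_cont x : continuous f x := lipschitz_continuous L f x f_lip.

Lemma RInt_reflect (u : R -> R) :
  (forall x, continuous u x) -> (forall x, u (2 * h - x) = u x) ->
  RInt u 0 (2 * h) = 2 * RInt u 0 h.
Proof.
  intros Hu Hr.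
  assert (E : RInt u h (2 * h) = RInt u 0 h).
  { rewrite <- (opp_RInt_swap u) by now apply continuous_ex_RInt.
    replace (2 * h) with (-1 * 0 + 2 * h) by ring.
    replace h with (-1 * h + 2 * h) at 2 by ring.
    rewrite <- (RInt_comp_lin u) by now apply continuous_ex_RInt.
    rewrite (RInt_ext _ (fun y => -1 * u y)).
    - rewrite RInt_Rmult by now apply continuous_ex_RInt.
      assert (Hopp : forall r : R, - (-1 * r) = r) by (intros r; ring).
      apply Hopp.
    - intros x _; rewrite <- (Hr x).
      now replace (-1 * x + 2 * h) with (2 * h - x) by ring. }
  rewrite (RInt_Rchasles u h) by exact Hu.
  rewrite E; apply Rplus_diag.
Qed.

(** This is what makes [averaging] applicable to |f(x) - f(y)|. *)
Lemma oscillation_lipschitz x x' y y' :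
  Rabs (Rabs (f x - f y) - Rabs (f x' - f y'))
  <= L * (Rabs (x - x') + Rabs (y - y')).
Proof.
  eapply Rle_trans; [apply Rabs_triang_inv2 |].
  replace (f x - f y - (f x' - f y')) with ((f x - f x') + - (f y - f y')) by ring.
  eapply Rle_trans; [apply Rabs_triang |]; rewrite Rabs_Ropp.
  pose proof (f_lip x x'); pose proof (f_lip y y'); lra.
Qed.

Let G (x : R) : R := RInt (fun y => Rabs (f x - f y)) 0 (2 * h).
Let F (x : R) : R := RInt f 0 x.

Hypothesis f_decr : forall x y, 0 <= x -> x <= y -> y <= h -> f y <= f x.

(** Monotonicity fixes the sign of f(x) - f(y) on either side of y = x. *)
Lemma slice_oscillation x :
  0 <= x <= h -> G x = 2 * (2 * F x - F h + (h - 2 * x) * f x).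
Proof.
  intros Hx.
  assert (Hc : forall y, continuous (fun y => Rabs (f x - f y)) y).
  { intros y; apply (lipschitz_continuous L); intros z z'.
    pose proof (oscillation_lipschitz x x z z') as H.
    now rewrite Rminus_diag, Rabs_R0, Rplus_0_l in H. }
  assert (Hexc : forall a b, ex_RInt (fun _ => f x) a b)
    by (intros; apply (ex_RInt_const (V := R_NormedModule))).
  assert (Hexf : forall a b, ex_RInt f a b)
    by (intros; now apply continuous_ex_RInt).
  assert (Hconst : forall a b, RInt (fun _ => f x) a b = (b - a) * f x)
    by (intros; apply (RInt_const (V := R_CompleteNormedModule))).
  assert (E1 : RInt (fun y => Rabs (f x - f y)) 0 x = F x - x * f x).
  { rewrite (RInt_ext _ (fun y => f y - f x)).
    - rewrite RInt_Rminus, Hconst, Rminus_0_r by auto; reflexivity.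
    - intros y; rewrite Rmin_left, Rmax_right by lra; intros Hy.
      rewrite Rabs_minus_sym; apply Rabs_pos_eq.
      assert (f x <= f y) by (apply f_decr; lra); lra. }
  assert (E2 : RInt (fun y => Rabs (f x - f y)) x h = (h - x) * f x - (F h - F x)).
  { rewrite (RInt_ext _ (fun y => f x - f y)).
    - rewrite RInt_Rminus, Hconst by auto.
      assert (EF : F h = F x + RInt f x h) by now apply RInt_Rchasles.
      rewrite EF; f_equal; symmetry; apply Rplus_minus_l.
    - intros y; rewrite Rmin_left, Rmax_right by lra; intros Hy.
      apply Rabs_pos_eq.
      assert (f y <= f x) by (apply f_decr; lra); lra. }
  unfold G; rewrite RInt_reflect.
  - rewrite (RInt_Rchasles _ x) by exact Hc.
    rewrite E1, E2.
    ring.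
  - exact Hc.
  - intros y; now rewrite f_refl.
Qed.

Lemma weight_continuous x : continuous (fun x => (h - 2 * x) * f x) x.
Proof.
  apply (continuous_mult (fun x => h - 2 * x) f); [| apply f_cont].
  apply (ex_derive_continuous (fun x => h - 2 * x)); auto_derive; exact I.
Qed.

Lemma primitive_derive x : is_derive F x (f x).
Proof.
  apply (is_derive_RInt f F 0 x); [| apply f_cont].
  apply filter_forall; intros b.
  apply (RInt_correct f 0 b); now apply continuous_ex_RInt.
Qed.

(** The formula for G is 4 (h - 2x) f(x) plus the derivative of P, and
    P(0) = P(h) = 0, so that only the weighted integral of f remains. *)
Lemma mean_slice_oscillation :
  RInt G 0 h = 4 * RInt (fun x => (h - 2 * x) * f x) 0 h.
Proof.
  set (P := fun x => 2 * ((2 * x - h) * F x - x * F h)).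
  set (p := fun x => 2 * (2 * F x + (2 * x - h) * f x - F h)).
  assert (HP : is_RInt p 0 h 0).
  { replace 0 with (minus (P h) (P 0)) at 2.
    - apply (is_RInt_derive P p 0 h).
      + intros x _; unfold P, p.
        auto_derive; [repeat split; exists (f x); apply primitive_derive |].
        change (Derive (fun x0 => F x0) x) with (Derive F x).
        rewrite (is_derive_unique _ _ _ (primitive_derive x)); ring.
      + intros x _; unfold p.
        apply (continuous_mult (fun _ => 2)); [apply continuous_const |].
        apply (continuous_minus (fun x => 2 * F x + (2 * x - h) * f x) (fun _ => F h));
          [| apply continuous_const].
        apply (continuous_plus (fun x => 2 * F x) (fun x => (2 * x - h) * f x)).
        * apply (continuous_mult (fun _ => 2)); [apply continuous_const |].
          apply (ex_derive_continuous F); exists (f x); apply primitive_derive.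
        * apply (continuous_mult (fun x => 2 * x - h) f); [| apply f_cont].
          apply (ex_derive_continuous (fun x => 2 * x - h)); auto_derive; exact I.
    - assert (F0 : F 0 = 0) by apply (RInt_point (V := R_CompleteNormedModule)).
      unfold P, minus, plus, opp; simpl; rewrite F0; ring. }
  assert (Hw : ex_RInt (fun x => (h - 2 * x) * f x) 0 h)
    by (apply continuous_ex_RInt, weight_continuous).
  assert (HW := is_RInt_scal _ _ _ 4 _ (RInt_correct _ _ _ Hw)).
  assert (HS := is_RInt_plus _ _ _ _ _ _ HP HW).
  rewrite <- (Rplus_0_l (4 * RInt _ 0 h)).
  apply is_RInt_unique.
  refine (is_RInt_ext _ _ _ _ _ _ HS).
  intros x; rewrite Rmin_left, Rmax_right by lra; intros Hx.
  rewrite slice_oscillation by lra.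
  unfold p, plus, scal; simpl; unfold mult; simpl; ring.
Qed.

Hypothesis f_per : forall x, f (x + 2 * h) = f x.

Theorem oscillation_limit :
  is_lim_seq (fun k => RInt (fun x => Rabs (f x - f (INR k * x))) 0 (2 * h))
             (Finite (4 / h * RInt (fun x => (h - 2 * x) * f x) 0 h)).
Proof.
  assert (HG : forall x, continuous G x).
  { intros x; apply (lipschitz_continuous (L * (2 * h))).
    apply (slice_integral_lipschitz (fun x y => Rabs (f x - f y)));
      [lra | apply oscillation_lipschitz]. }
  assert (Gr : forall x, G (2 * h - x) = G x) by (intros x; unfold G; now rewrite f_refl).
  replace (4 / h * RInt (fun x => (h - 2 * x) * f x) 0 h)
    with (RInt G 0 (2 * h) / (2 * h)).
  - apply (averaging (fun x y => Rabs (f x - f y)) L (2 * h)).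
    + lra.
    + apply oscillation_lipschitz.
    + intros x y; now rewrite f_per.
  - rewrite (RInt_reflect G HG Gr), mean_slice_oscillation; field; lra.
Qed.

End Oscillation.

(** * Powers of the cosine *)

Lemma cos_pow_lipschitz n : lipschitz (INR n) (fun x => cos x ^ n).
Proof.
  intros x y.
  destruct (MVT_gen (fun x => cos x ^ n) y x
              (fun x => INR n * - sin x * cos x ^ pred n)) as (c & _ & Hc).
  - intros t _; auto_derive; [exact I | ring].
  - intros t _; apply continuity_pt_filterlim.
    apply (ex_derive_continuous (fun x => cos x ^ n)); auto_derive; exact I.
  - rewrite Hc, !Rabs_mult, Rabs_Ropp, (Rabs_pos_eq (INR n)) by apply pos_INR.
    rewrite <- RPow_abs.
    assert (Hs : Rabs (sin c) <= 1) by (apply Rabs_le, SIN_bound).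
    assert (Hp : 0 <= Rabs (cos c) ^ pred n <= 1).
    { split; [apply pow_le, Rabs_pos |].
      rewrite <- (pow1 (pred n)); apply pow_incr.
      split; [apply Rabs_pos | apply Rabs_le, COS_bound]. }
    assert (H1 : Rabs (sin c) * Rabs (cos c) ^ pred n <= 1 * 1)
      by (apply Rmult_le_compat; [apply Rabs_pos | | |]; lra).
    pose proof (pos_INR n); pose proof (Rabs_pos (x - y)).
    apply Rmult_le_compat_r; [assumption |].
    pose proof (Rmult_le_compat_l (INR n) _ _ H H1); lra.
Qed.

Lemma even_pow_opp n (x : R) : Nat.Even n -> (- x) ^ n = x ^ n.
Proof.
  intros [p ->]; rewrite !pow_mult; f_equal; ring.
Qed.

Lemma cos_pow_decreasing n x y :
  0 <= x -> x <= y -> y <= PI / 2 -> cos y ^ n <= cos x ^ n.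
Proof.
  intros Hx Hxy Hy; pose proof PI_RGT_0.
  apply pow_incr; split; [apply cos_ge_0; lra | apply cos_decr_1; lra].
Qed.

(** Pascal's rule as a summation by shifts.  The proof goes through partial
    sums, which differ by the boundary term C(n,N) a(N+1): [Binomial.C n (S n)]
    is not 0, so the sums cannot simply be extended past n. *)
Lemma binomial_sum_pascal n (a : nat -> R) :
  sum_f_R0 (fun m => Binomial.C (S n) m * a m) (S n)
  = sum_f_R0 (fun m => Binomial.C n m * (a m + a (S m))) n.
Proof.
  assert (C0 : forall k, Binomial.C k 0 = 1).
  { intros k; unfold Binomial.C; rewrite Nat.sub_0_r; simpl.
    field; apply INR_fact_neq_0. }
  assert (Cn : forall k, Binomial.C k k = 1).
  { intros k; rewrite (pascal_step1 k k), Nat.sub_diag by lia; apply C0. }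
  assert (H : forall N, (N <= n)%nat ->
    sum_f_R0 (fun m => Binomial.C (S n) m * a m) N + Binomial.C n N * a (S N)
    = sum_f_R0 (fun m => Binomial.C n m * (a m + a (S m))) N).
  { induction N as [|N IH]; intros HN.
    - simpl; rewrite !C0; ring.
    - rewrite !tech5, <- IH, <- pascal by lia; ring. }
  rewrite tech5, <- H, !Cn by lia; ring.
Qed.

(** Multiplying by 2 cos x splits each cos(c x) into cos((c+1) x) and
    cos((c-1) x), which is the shift in [binomial_sum_pascal]. *)
Lemma cos_pow_fourier n x :
  2 ^ n * cos x ^ n
  = sum_f_R0 (fun m => Binomial.C n m * cos ((INR n - 2 * INR m) * x)) n.
Proof.
  induction n as [|n IH].
  - simpl; unfold Binomial.C; simpl.
    rewrite Rmult_0_r, Rminus_0_r, Rmult_0_l, cos_0; field.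
  - rewrite (binomial_sum_pascal n (fun m => cos ((INR (S n) - 2 * INR m) * x))).
    replace (2 ^ S n * cos x ^ S n) with ((2 * cos x) * (2 ^ n * cos x ^ n))
      by (simpl; ring).
    rewrite IH, scal_sum.
    apply sum_eq; intros m _.
    rewrite !S_INR, form1.
    replace (((INR n + 1 - 2 * INR m) * x - (INR n + 1 - 2 * (INR m + 1)) * x) / 2)
      with x by field.
    replace (((INR n + 1 - 2 * INR m) * x + (INR n + 1 - 2 * (INR m + 1)) * x) / 2)
      with ((INR n - 2 * INR m) * x) by field.
    ring.
Qed.

(** * Weighted integrals of the Fourier modes *)

Definition weighted_cos_integral (c : R) : R :=
  RInt (fun x => (PI / 2 - 2 * x) * cos (c * x)) 0 (PI / 2).

Lemma weighted_cos_ex_RInt c :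
  ex_RInt (fun x => (PI / 2 - 2 * x) * cos (c * x)) 0 (PI / 2).
Proof.
  apply continuous_ex_RInt; intros x.
  apply (ex_derive_continuous (fun x => (PI / 2 - 2 * x) * cos (c * x))).
  auto_derive; exact I.
Qed.

Lemma weighted_cos_integral_opp c :
  weighted_cos_integral (- c) = weighted_cos_integral c.
Proof.
  apply RInt_ext; intros x _; f_equal.
  rewrite Ropp_mult_distr_l_reverse; apply cos_neg.
Qed.

Lemma weighted_cos_integral_primitive c (Q : R -> R) :
  (forall x, is_derive Q x ((PI / 2 - 2 * x) * cos (c * x))) ->
  weighted_cos_integral c = Q (PI / 2) - Q 0.
Proof.
  intros HQ; apply is_RInt_unique.
  apply (is_RInt_derive Q); intros x _; [apply HQ |].
  apply (ex_derive_continuous (fun x => (PI / 2 - 2 * x) * cos (c * x))).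
  auto_derive; exact I.
Qed.

Lemma weighted_cos_integral_0 : weighted_cos_integral 0 = 0.
Proof.
  rewrite (weighted_cos_integral_primitive 0 (fun x => PI / 2 * x - x ^ 2)).
  - field.
  - intros x; auto_derive; [exact I |].
    rewrite Rmult_0_l, cos_0; simpl; ring.
Qed.

Lemma weighted_cos_integral_even_frequency q :
  q <> 0%nat ->
  weighted_cos_integral (2 * INR q) = (1 - cos (INR q * PI)) / (2 * INR q ^ 2).
Proof.
  intros Hq; assert (Hq0 : INR q <> 0) by now apply not_0_INR.
  rewrite (weighted_cos_integral_primitive _
             (fun x => (PI / 2 - 2 * x) * sin (2 * INR q * x) / (2 * INR q)
                       - 2 * cos (2 * INR q * x) / (2 * INR q) ^ 2)).
  - replace (2 * INR q * (PI / 2)) with (INR q * PI) by field.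
    rewrite !Rmult_0_r, sin_0, cos_0.
    assert (Hs : sin (INR q * PI) = 0).
    { apply sin_eq_0_1; exists (Z.of_nat q); now rewrite <- INR_IZR_INZ. }
    rewrite Hs; field; exact Hq0.
  - intros x; auto_derive; [exact I |].
    field; exact Hq0.
Qed.

Lemma cos_pow_weighted_integral n :
  RInt (fun x => (PI / 2 - 2 * x) * cos x ^ n) 0 (PI / 2)
  = / 2 ^ n * sum_f_R0 (fun m => Binomial.C n m
                                 * weighted_cos_integral (INR n - 2 * INR m)) n.
Proof.
  set (u := fun m x => (PI / 2 - 2 * x) * cos ((INR n - 2 * INR m) * x)).
  assert (Hsum : forall N,
    is_RInt (fun x => sum_f_R0 (fun m => Binomial.C n m * u m x) N) 0 (PI / 2)
      (sum_f_R0 (fun m => Binomial.C n m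
                          * weighted_cos_integral (INR n - 2 * INR m)) N)).
  { assert (Hterm : forall m,
      is_RInt (fun x => Binomial.C n m * u m x) 0 (PI / 2)
        (Binomial.C n m * weighted_cos_integral (INR n - 2 * INR m))).
    { intros m; apply (is_RInt_scal (u m) 0 (PI / 2) (Binomial.C n m)).
      apply (RInt_correct (u m)), weighted_cos_ex_RInt. }
    induction N as [|N IH]; [apply Hterm |].
    exact (is_RInt_plus _ _ _ _ _ _ IH (Hterm (S N))). }
  apply is_RInt_unique.
  assert (HS := is_RInt_scal _ _ _ (/ 2 ^ n) _ (Hsum n)).
  refine (is_RInt_ext _ _ _ _ _ _ HS).
  intros x _; unfold scal; simpl; unfold mult; simpl.
  rewrite (sum_eq _ (fun m => Binomial.C n m * cos ((INR n - 2 * INR m) * x)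
                              * (PI / 2 - 2 * x)))
    by (intros m _; unfold u; ring).
  rewrite <- scal_sum, <- cos_pow_fourier.
  field; apply pow_nonzero; lra.
Qed.

(** * Symmetry and parity in the binomial sum *)

(** Induction peels off the first and the last term together. *)
Lemma sum_fold r (b : nat -> R) :
  (forall m, (m <= r)%nat -> b (2 * r + 2 - m)%nat = b m) ->
  sum_f_R0 b (2 * r + 2) = 2 * sum_f_R0 b r + b (S r).
Proof.
  revert b; induction r as [|r IH]; intros b Hb.
  - simpl; specialize (Hb 0%nat (Nat.le_refl 0)); simpl in Hb; rewrite Hb; ring.
  - replace (2 * S r + 2)%nat with (S (S (2 * r + 2))) by lia.
    rewrite tech5, decomp_sum by lia; rewrite Nat.pred_succ.
    rewrite (IH (fun i => b (S i))).
    + assert (E : b (S (S (2 * r + 2))) = b 0%nat)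
        by (rewrite <- (Hb 0%nat) by lia; f_equal; lia).
      rewrite E, (decomp_sum b (S r)) by lia; rewrite Nat.pred_succ; ring.
    + intros m Hm; rewrite <- (Hb (S m)) by lia; f_equal; lia.
Qed.

Lemma sum_even_indices r (b : nat -> R) :
  (forall j, (j < r)%nat -> b (2 * j + 1)%nat = 0) ->
  sum_f_R0 b (2 * r) = sum_f_R0 (fun j => b (2 * j)%nat) r.
Proof.
  intros Hb; induction r as [|r IH]; [reflexivity |].
  rewrite tech5, <- IH by (intros j Hj; apply Hb; lia).
  replace (2 * S r)%nat with (S (S (2 * r))) by lia.
  rewrite !tech5; replace (S (2 * r)) with (2 * r + 1)%nat by lia.
  rewrite Hb by lia; ring.
Qed.

Lemma sum_odd_indices r (b : nat -> R) :
  (forall j, (j <= r)%nat -> b (2 * j)%nat = 0) ->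
  sum_f_R0 b (2 * r + 1) = sum_f_R0 (fun j => b (2 * j + 1)%nat) r.
Proof.
  intros Hb; replace (2 * r + 1)%nat with (S (2 * r)) by lia.
  induction r as [|r IH].
  - pose proof (Hb 0%nat (Nat.le_refl 0)) as H0; simpl in H0 |- *; lra.
  - replace (2 * S r)%nat with (S (S (2 * r))) by lia.
    rewrite 2!tech5, IH by (intros j Hj; apply Hb; lia).
    replace (S (S (2 * r))) with (2 * S r)%nat by lia.
    rewrite Hb, tech5 by lia.
    replace (S (2 * S r)) with (2 * S r + 1)%nat by lia; ring.
Qed.

Definition cos_pow_term (n m : nat) : R :=
  Binomial.C n m * weighted_cos_integral (INR n - 2 * INR m).

Lemma cos_pow_term_reflect n m :
  (m <= n)%nat -> cos_pow_term n (n - m) = cos_pow_term n m.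
Proof.
  intros Hm; unfold cos_pow_term.
  rewrite <- pascal_step1, minus_INR, <- weighted_cos_integral_opp by exact Hm.
  do 2 f_equal; ring.
Qed.

Lemma cos_pow_term_middle p : cos_pow_term (2 * p) p = 0.
Proof.
  unfold cos_pow_term; rewrite mult_INR.
  replace (INR 2 * INR p - 2 * INR p) with 0 by (simpl; ring).
  rewrite weighted_cos_integral_0; ring.
Qed.

Lemma cos_pow_term_value n m q :
  q <> 0%nat -> n = (2 * (m + q))%nat ->
  cos_pow_term n m = Binomial.C n m * ((1 - cos (INR q * PI)) / (2 * INR q ^ 2)).
Proof.
  intros Hq Hn; unfold cos_pow_term.
  rewrite <- (weighted_cos_integral_even_frequency q Hq), Hn.
  rewrite mult_INR, plus_INR; do 2 f_equal; simpl; ring.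
Qed.

(** The gap n/2 - m is written 2 (t + 1) to keep it positive: the closed form
    of the weighted integral divides by it. *)
Lemma cos_pow_term_even_gap n m t :
  n = (2 * (m + 2 * S t))%nat -> cos_pow_term n m = 0.
Proof.
  intros Hn; rewrite (cos_pow_term_value n m (2 * S t)) by lia.
  replace (INR (2 * S t) * PI) with (0 + 2 * INR (S t) * PI)
    by (rewrite mult_INR; simpl; ring).
  rewrite cos_period, cos_0; unfold Rdiv; ring.
Qed.

Lemma cos_pow_term_odd_gap n m t :
  n = (2 * (m + (2 * t + 1)))%nat ->
  cos_pow_term n m = Binomial.C n m * (1 / (INR n / 2 - INR m) ^ 2).
Proof.
  intros Hn; rewrite (cos_pow_term_value n m (2 * t + 1)) by lia.
  assert (Hc : cos (INR (2 * t + 1) * PI) = - 1).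
  { replace (INR (2 * t + 1) * PI) with (PI + 2 * INR t * PI)
      by (rewrite plus_INR, mult_INR; simpl; ring).
    rewrite cos_period; apply cos_PI. }
  assert (Hq : INR (2 * t + 1) <> 0) by (apply not_0_INR; lia).
  rewrite Hc; replace (INR n / 2 - INR m) with (INR (2 * t + 1)).
  - f_equal; field; exact Hq.
  - rewrite Hn, mult_INR, (plus_INR m); simpl (INR 2); field.
Qed.

(** Writing n = 2r + 2 makes the indices below n/2 exactly 0, ..., r. *)
Lemma limiting_area_fourier r :
  is_limiting_area (2 * r + 2)
    (16 / (2 ^ (2 * r + 2) * PI) * sum_f_R0 (cos_pow_term (2 * r + 2)) r).
Proof.
  set (n := (2 * r + 2)%nat).
  assert (Hn : Nat.Even n) by (exists (S r); unfold n; lia).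
  pose proof PI_RGT_0 as HPI.
  assert (Hfold : sum_f_R0 (cos_pow_term n) n = 2 * sum_f_R0 (cos_pow_term n) r).
  { unfold n at 2; rewrite sum_fold.
    - replace n with (2 * S r)%nat by (unfold n; lia).
      rewrite cos_pow_term_middle; ring.
    - intros m Hm; apply cos_pow_term_reflect; unfold n; lia. }
  assert (H : is_lim_seq
    (fun k => RInt (fun x => Rabs (cos x ^ n - cos (INR k * x) ^ n)) 0 (2 * (PI / 2)))
    (Finite (4 / (PI / 2) * RInt (fun x => (PI / 2 - 2 * x) * cos x ^ n) 0 (PI / 2)))).
  { apply (oscillation_limit (fun x => cos x ^ n) (INR n) (PI / 2)).
    - lra.
    - apply cos_pow_lipschitz.
    - intros x; rewrite <- (even_pow_opp n (cos x)) by exact Hn; f_equal.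
      replace (2 * (PI / 2) - x) with (- (x - PI)) by field.
      rewrite cos_neg, cos_minus, cos_PI, sin_PI; ring.
    - intros x y; apply cos_pow_decreasing.
    - intros x; rewrite <- (even_pow_opp n (cos x)) by exact Hn; f_equal.
      replace (2 * (PI / 2)) with PI by field; apply neg_cos. }
  replace (2 * (PI / 2)) with PI in H by field.
  rewrite cos_pow_weighted_integral in H.
  change (fun m => Binomial.C n m * weighted_cos_integral (INR n - 2 * INR m))
    with (cos_pow_term n) in H.
  rewrite Hfold in H.
  replace (16 / (2 ^ n * PI) * sum_f_R0 (cos_pow_term n) r)
    with (4 / (PI / 2) * (/ 2 ^ n * (2 * sum_f_R0 (cos_pow_term n) r))).
  - exact H.
  - field; split; [lra | apply pow_nonzero; lra].
Qed.

(** * The limiting area *)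

Theorem theorem2 (n : nat) (hpos : (0 < n)%nat) (heven : Nat.Even n) :
  ((n mod 4)%nat = 2%nat ->
     is_limiting_area n
       (16 / (2 ^ n * PI) *
        sum_f_R0
          (fun j : nat =>
             Binomial.C n (2 * j) * (1 / (INR n / 2 - INR (2 * j)) ^ 2))
          ((n - 2) / 4)%nat))
  /\
  ((n mod 4)%nat = 0%nat ->
     is_limiting_area n
       (16 / (2 ^ n * PI) *
        sum_f_R0
          (fun j : nat =>
             Binomial.C n (2 * j + 1) * (1 / (INR n / 2 - INR (2 * j + 1)) ^ 2))
          ((n - 4) / 4)%nat)).
Proof.
  pose proof (Nat.div_mod_eq n 4) as Hdiv.
  split; intros Hmod; rewrite Hmod in Hdiv.
  - set (r := (n / 4)%nat) in Hdiv.
    replace ((n - 2) / 4)%nat with r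
      by (apply (Nat.div_unique _ _ _ 0); lia).
    rewrite (sum_eq _ (fun j => cos_pow_term n (2 * j))).
    + rewrite <- sum_even_indices.
      * replace n with (2 * (2 * r) + 2)%nat by lia.
        apply limiting_area_fourier.
      * intros j Hj; apply (cos_pow_term_even_gap _ _ (r - j - 1)); lia.
    + intros j Hj; symmetry; apply (cos_pow_term_odd_gap _ _ (r - j)); lia.
  - destruct (n / 4)%nat as [|r]; [lia |].
    replace ((n - 4) / 4)%nat with r
      by (apply (Nat.div_unique _ _ _ 0); lia).
    rewrite (sum_eq _ (fun j => cos_pow_term n (2 * j + 1))).
    + rewrite <- (sum_odd_indices r (cos_pow_term n)).
      * replace n with (2 * (2 * r + 1) + 2)%nat by lia.
        apply limiting_area_fourier.
      * intros j Hj; apply (cos_pow_term_even_gap _ _ (r - j)); lia.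
    + intros j Hj; symmetry; apply (cos_pow_term_odd_gap _ _ (r - j)); lia.
Qed.
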